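(* Let $\alpha>0$, $A\ge0$, $B>0$, $t>0$, and let $P_n(x,t)$ be the monic polynomials orthogonal on $[0,\infty)$ w.r.t. $w(x,t)=x^\alpha e^{-x}(A+B\theta(x-t))$, with norms $h_n(t)=\int_0^\infty P_n^2w\,dx$. Let $R_n(t)=Bt^\alpha e^{-t}\{P_n(t,t)\}^2/h_n(t)$ for $n\ge0$, $r_n(t)=Bt^\alpha e^{-t}P_n(t,t)P_{n-1}(t,t)/h_{n-1}(t)$ for $n\ge1$, and $r_0(t)=0$. Then $$r_{n+1}+r_n=R_n(t-2n-\alpha-1-tR_n)\quad(n\ge0),$$ $$r_n^2\left(\frac{1}{R_nR_{n-1}}-\frac{1}{R_n}-\frac{1}{R_{n-1}}\right)=r_n(2n+\alpha)+n(n+\alpha)\quad(n\ge1),$$ with initial conditions $r_0(t)=0$, $R_0(t)=Bt^\alpha e^{-t}/h_0(t)$, $h_0(t)=A\,\Gamma(1+\alpha)+B\int_t^\infty x^\alpha e^{-x}\,dx$.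
   Context: $\theta$ is the Heaviside function ($1$ for $x>0$, $0$ otherwise); $P_n(t,t)$ is $P_n(x,t)$ at $x=t$; $P_{-1}:=0$.
   Formalization: The second identity is stated only when P_n(t,t) and P_{n-1}(t,t) are both nonzero, since otherwise R_n or R_{n-1} vanishes and 1/R_n or 1/R_{n-1} is undefined (this does occur for some t when A>0). *)

(* Defs.v *)
From HB Require Import structures.
From mathcomp Require Import all_boot all_order all_algebra.
From mathcomp Require Import all_classical all_reals all_analysis.
Set Implicit Arguments. Unset Strict Implicit. Unset Printing Implicit Defensive.
Import Order.TTheory GRing.Theory Num.Theory.
Import numFieldNormedType.Exports.
Local Open Scope classical_set_scope.
Local Open Scope ring_scope.

Section Defs.
Variable R : realType.

Definition heaviside (x : R) : R := if 0 < x then 1 else 0.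

Definition Gamma (s : R) : R :=
  Rintegral lebesgue_measure `[0, +oo[ (fun x => powR x (s - 1) * expR (- x)).

Definition weight (alpha A B t : R) (x : R) : R :=
  powR x alpha * expR (- x) * (A + B * heaviside (x - t)).

Definition wip (alpha A B t : R) (p q : {poly R}) : R :=
  Rintegral lebesgue_measure `[0, +oo[
    (fun x => p.[x] * q.[x] * weight alpha A B t x).

Definition monic_OPS (alpha A B t : R) (P : nat -> {poly R}) : Prop :=
  (forall n, P n \is monic /\ size (P n) = n.+1) /\
  (forall m n, m <> n -> wip alpha A B t (P m) (P n) = 0).

Definition hn (alpha A B t : R) (P : nat -> {poly R}) (n : nat) : R :=
  wip alpha A B t (P n) (P n).

Definition Rn (alpha A B t : R) (P : nat -> {poly R}) (n : nat) : R :=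
  B * powR t alpha * expR (- t) * (P n).[t] ^+ 2 / hn alpha A B t P n.

Definition rn (alpha A B t : R) (P : nat -> {poly R}) (n : nat) : R :=
  match n with
  | 0 => 0
  | m.+1 => B * powR t alpha * expR (- t) * (P n).[t] * (P m).[t]
              / hn alpha A B t P m
  end.

End Defs.

(* Main.v *)
Require Import Defs.
From HB Require Import structures.
From mathcomp Require Import all_boot all_order all_algebra ring lra.
From mathcomp Require Import all_classical all_reals all_analysis.
From mathcomp Require Import measurable_realfun.
Import Order.TTheory GRing.Theory Num.Theory.
Import numFieldNormedType.Exports.
Set Implicit Arguments.
Unset Strict Implicit.
Unset Printing Implicit Defensive.
Local Open Scope classical_set_scope.
Local Open Scope ring_scope.

(** Write L p for the integral of p w, c = B t^alpha e^-t, and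
x P_n = P_(n+1) + a_n P_n + b_n P_(n-1).  Integration by parts gives
L(x q' + (alpha + 1 - x) q) = - c t q(t) for every polynomial q, and nothing else
about the weight is needed except h_n <> 0.  Taking q = P_n^2 yields
a_n = 2 n + alpha + 1 + t R_n, and the first equation is the three-term
recurrence at x = t.  Taking q = P_n P_k for k < n expands x P_n' in the P_k,
where the jump contributes a Christoffel-Darboux kernel; at x = 0 this becomes
  (n + r_n) P_n(0) + b_n (1 - R_n) P_(n-1)(0) = 0,
  (1 - R_(n-1)) P_n(0) + (n + alpha + r_n) P_(n-1)(0) = 0.
Two consecutive P_n have no common zero, so the determinant of this system
vanishes; with r_n^2 = b_n R_n R_(n-1) that is the second equation. *)

(** * Orthogonal polynomials of an abstract linear functional *)

Section SemiclassicalOPS.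
Variables (F : fieldType) (L : {poly F} -> F) (P : nat -> {poly F}).
Hypothesis LD : forall p q : {poly F}, L (p + q) = L p + L q.
Hypothesis LZ : forall a (p : {poly F}), L (a *: p) = a * L p.
Hypothesis P_monic : forall n, P n \is monic.
Hypothesis P_size : forall n, size (P n) = n.+1.
Hypothesis P_orth : forall m n, m <> n -> L (P m * P n) = 0.

Local Notation h n := (L (P n * P n)).

Hypothesis h_neq0 : forall n, h n != 0.

Lemma L0 : L 0 = 0.
Proof. by rewrite -(scale0r 0) LZ mul0r. Qed.

Lemma LB p q : L (p - q) = L p - L q.
Proof. by rewrite -scaleN1r LD LZ mulN1r. Qed.

Lemma L_sum I (r : seq I) (Q : pred I) (f : I -> {poly F}) :
  L (\sum_(i <- r | Q i) f i) = \sum_(i <- r | Q i) L (f i).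
Proof. exact: (big_morph _ LD L0). Qed.

Lemma coefP_id n : (P n)`_n = 1.
Proof. by have /monicP := P_monic n; rewrite lead_coefE P_size. Qed.

Lemma coefP_gt n k : (n < k)%N -> (P n)`_k = 0.
Proof. by move=> nk; rewrite nth_default// P_size. Qed.

Lemma size_reduce n (q : {poly F}) :
  (size q <= n.+1)%N -> (size (q - q`_n *: P n)%R <= n)%N.
Proof.
move=> sq; apply/leq_sizeP => k; rewrite leq_eqVlt => /predU1P[<-|nk].
  by rewrite coefB coefZ coefP_id mulr1 subrr.
by rewrite coefB coefZ coefP_gt// mulr0 subr0 nth_default// (leq_trans sq).
Qed.

(** Peeling off a multiple of [P k] by [size_reduce] lowers the size of [q], and every index k met
    on the way is below n. *)
Lemma orth_low n (q : {poly F}) : (size q <= n)%N -> L (P n * q) = 0.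
Proof.
have [m sm] := ubnP (size q); elim: m => // m IH in q sm *.
case sq : (size q) => [|k] kn.
  by move/eqP: sq; rewrite size_poly_eq0 => /eqP ->; rewrite mulr0 L0.
have := @size_reduce k q; rewrite sq => /(_ (leqnn _)) sr.
rewrite -[q in LHS](subrK (q`_k *: P k)) mulrDr LD -scalerAr LZ.
rewrite P_orth; last by move=> nk; move: kn; rewrite nk ltnn.
rewrite mulr0 addr0 IH//; last exact: leq_trans sr (ltnW kn).
by apply: leq_ltn_trans sr _; move: sm; rewrite sq ltnS.
Qed.

Lemma orth_lead n (q : {poly F}) :
  (size q <= n.+1)%N -> L (P n * q) = q`_n * h n.
Proof.
move=> /size_reduce sr.
rewrite -[q in LHS](subrK (q`_n *: P n)) mulrDr LD orth_low// add0r.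
by rewrite -scalerAr LZ.
Qed.

(** As the norms are nonzero, pairing with the [P k] detects the coefficients of [q] from the top
    down. The polynomial identities below are proved by such testing. *)
Lemma orth_eq0 n (q : {poly F}) : (size q <= n)%N ->
  (forall k, (k < n)%N -> L (P k * q) = 0) -> q = 0.
Proof.
elim: n q => [|n IH] q sq Lq; first by apply/eqP; rewrite -size_poly_eq0 -leqn0.
have /eqP := Lq n (leqnn _); rewrite orth_lead// mulf_eq0 (negPf (h_neq0 _)) orbF.
move=> /eqP qn0; apply: IH => [|k kn]; last by apply: Lq; exact: ltnW.
by have := size_reduce sq; rewrite qn0 scale0r subr0.
Qed.

Definition recA n := L (P n * ('X * P n)) / h n.
(* recB 0 = 0 lets n = 0 share the formulas, in which P n.-1 is then P 0. *)
Definition recB n := if n is m.+1 then h n / h m else 0.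

(** Multiplication by ['X] is symmetric for [L]: when k < n it moves onto [P k], and only the
    coefficient of degree n of ['X * P k] counts. *)
Lemma orth_X n k : (k <= n)%N ->
  L (P k * ('X * P n)) = (if k == n then recA n * h n else
    if k.+1 == n then h n else 0).
Proof.
move=> kn; case: eqVneq => [->|kNn]; first by rewrite /recA divfK.
have {kn kNn} kn : (k < n)%N by rewrite ltn_neqAle kNn.
rewrite (_ : P k * _ = P n * ('X * P k)); last by ring.
rewrite orth_lead; last first.
  by rewrite (leq_trans (size_polyMleq _ _))// size_polyX P_size.
rewrite coefXM; case: n kn => // n; rewrite ltnS leq_eqVlt eqSS /=.
case: eqVneq => [-> _|_ /= kn]; first by rewrite coefP_id mul1r.
by rewrite coefP_gt// mul0r.
Qed.

Lemma orthE m n : L (P m * P n) = (m == n)%:R * h n.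
Proof. by case: eqVneq => [->|/eqP mn]; rewrite ?mul1r// P_orth// mul0r. Qed.

(** The leading terms cancel in the difference of the two sides, so [orth_eq0] reduces the identity
    to pairings with [P k] for k <= n. *)
Lemma three_term_recurrence n :
  'X * P n = P n.+1 + recA n *: P n + recB n *: P n.-1.
Proof.
apply/eqP; rewrite -subr_eq0; apply/eqP; apply: (@orth_eq0 n.+1).
  apply/leq_sizeP => k; rewrite !coefB !coefD !coefZ coefXM.
  have Pn1 : (n.-1 < n.+1)%N by rewrite ltnS leq_pred.
  rewrite leq_eqVlt => /predU1P[<-|]; first last.
    case: k => // k nk.
    by rewrite !coefP_gt ?(ltn_trans Pn1)//= 1?ltnW// !mulr0 !addr0 subrr.
  by rewrite /= !coefP_id !coefP_gt// !mulr0 !addr0 subrr.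
move=> k; rewrite ltnS => kn.
rewrite mulrBr !mulrDr -!scalerAr LB 2!LD 2!LZ orth_X//.
rewrite (orthE k n.+1) (orthE k n) (orthE k n.-1).
rewrite (ltn_eqF (_ : k < n.+1)%N)// mul0r add0r.
case: eqVneq => [->|kNn].
  case: n {kn} => [|n]; first by rewrite /recB !mul1r mul0r addr0 subrr.
  by rewrite /= (gtn_eqF (ltnSn _)) mul1r mul0r mulr0 addr0 subrr.
case: n kn kNn => [|n] kn kNn; first by rewrite leqn0 (negPf kNn) in kn.
rewrite eqSS /=; case: eqVneq => [_|_]; last by rewrite !mul0r !mulr0 addr0 subrr.
by rewrite mul0r mulr0 add0r mul1r divfK// subrr.
Qed.

Lemma three_term_horner n y :
  y * (P n).[y] = (P n.+1).[y] + recA n * (P n).[y] + recB n * (P n.-1).[y].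
Proof. by have /(congr1 (horner^~ y)) := three_term_recurrence n; rewrite !hornerE. Qed.

Lemma P0_1 : P 0 = 1.
Proof.
have /size1_polyC -> : (size (P 0) <= 1)%N by rewrite P_size.
by rewrite coefP_id.
Qed.

Lemma recB_neq0 n : recB n.+1 != 0.
Proof. by rewrite mulf_neq0// invr_neq0. Qed.

(** As [recB] is nonzero at positive indices, the recurrence carries a common zero down to [P 0],
    which is 1. *)
Lemma consecutive_nonroot n y : ~ ((P n.+1).[y] = 0 /\ (P n).[y] = 0).
Proof.
elim: n => [|n IH] [r1 r2].
  by move/eqP: r2; rewrite P0_1 hornerC oner_eq0.
apply: IH; split => //; have := three_term_horner n.+1 y.
rewrite r1 r2 !mulr0 !add0r /= => /esym/eqP.
by rewrite mulf_eq0 (negPf (recB_neq0 n)) => /eqP.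
Qed.

(** Induction through the recurrence, whose [recA] terms cancel by antisymmetry in x and y. Keeping
    y - x as a factor avoids dividing by it. *)
Lemma christoffel_darboux n x y :
  (y - x) * \sum_(k < n.+1) (P k).[x] / h k * (P k).[y] =
  ((P n.+1).[y] * (P n).[x] - (P n).[y] * (P n.+1).[x]) / h n.
Proof.
elim: n => [|n IH].
  rewrite big_ord_recr big_ord0 /= add0r.
  have := three_term_horner 0 x; have := three_term_horner 0 y.
  rewrite /= !mul0r !addr0 => ey ex.
  have -> : (P 1).[x] = x * (P 0).[x] - recA 0 * (P 0).[x] by rewrite ex addrK.
  have -> : (P 1).[y] = y * (P 0).[y] - recA 0 * (P 0).[y] by rewrite ey addrK.
  by field.
rewrite big_ord_recr /= mulrDr IH.
have -> : (P n.+2).[x] =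
    x * (P n.+1).[x] - recA n.+1 * (P n.+1).[x] - recB n.+1 * (P n).[x].
  by rewrite (three_term_horner n.+1 x) /=; ring.
have -> : (P n.+2).[y] =
    y * (P n.+1).[y] - recA n.+1 * (P n.+1).[y] - recB n.+1 * (P n).[y].
  by rewrite (three_term_horner n.+1 y) /=; ring.
rewrite /recB; field; by rewrite !h_neq0.
Qed.

(** * Consequences of the Pearson relation *)

Variables al c t : F.
Hypothesis pearson : forall q,
  L ('X * q^`() + (al + 1) *: q - 'X * q) = - (c * t * q.[t]).

Local Notation Rho n := (c * (P n).[t] ^+ 2 / h n).
(** [Rho] and [rho] are R_n and r_n, with [c] standing for B t^alpha e^-t. *)
Definition rho n := if n is m.+1 then c * (P n).[t] * (P m).[t] / h m else 0.

Lemma coefXderiv (q : {poly F}) n : ('X * q^`())`_n = q`_n *+ n.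
Proof. by rewrite coefXM; case: n => [|n] //=; rewrite coef_deriv. Qed.

Lemma size_XderivP n : (size ('X * (P n)^`())%R <= n.+1)%N.
Proof.
by apply/leq_sizeP => k nk; rewrite coefXderiv coefP_gt// mul0rn.
Qed.

Lemma recA_eq n : recA n = 2 * n%:R + al + 1 + t * Rho n.
Proof.
have := pearson (P n * P n); rewrite derivM LB LD LZ.
rewrite (_ : 'X * _ = P n * ('X * (P n)^`()) + P n * ('X * (P n)^`())); last by ring.
rewrite LD orth_lead ?size_XderivP// coefXderiv coefP_id hornerM.
rewrite mulrCA orth_X// eqxx => /eqP.
rewrite subr_eq [eqbRHS]addrC -subr_eq opprK => /eqP e.
have h0 := h_neq0 n; apply: (mulIf h0); rewrite -e -[1 *+ n]/(n%:R).
by field.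
Qed.

(** This is the recurrence at [t] times c P_n(t) / h_n; the ratio of norms in [recB n] turns the
    last term into [rho n]. *)
Lemma rho_recurrence n : rho n.+1 + rho n = Rho n * (t - recA n).
Proof.
have e := three_term_horner n t.
have -> : Rho n * (t - recA n) =
    c * (P n).[t] / h n * (t * (P n).[t] - recA n * (P n).[t]).
  by field.
rewrite e /rho /recB; case: n {e} => [|n] /=.
  by field.
by field; rewrite !h_neq0.
Qed.

(** The coefficients of degree n agree, so pairings with [P k] for k < n decide. In the Pearson
    relation for [P n * P k], degree and orthogonality leave only the pairing sought, an ['X] term
    present for k = n - 1, and the jump at [t]. *)
Lemma structure_relation n :
  'X * (P n)^`() = n%:R *: P n + recB n *: P n.-1
    - (t * c * (P n).[t]) *: \sum_(k < n) ((P k).[t] / h k) *: P k.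
Proof.
apply/eqP; rewrite -subr_eq0; apply/eqP; apply: (@orth_eq0 n).
  apply/leq_sizeP => j nj; rewrite coefB coefXderiv coefB coefD !coefZ coef_sum.
  rewrite big1 ?mulr0 ?subr0; last first.
    by move=> k _; rewrite coefZ coefP_gt ?mulr0// (leq_trans (ltn_ord k)).
  have -> : recB n * (P n.-1)`_j = 0.
    case: n nj => [|n] nj; first by rewrite /= mul0r.
    by rewrite coefP_gt ?mulr0//.
  rewrite addr0; move: nj; rewrite leq_eqVlt => /predU1P[<-|nj].
    by rewrite coefP_id mulr1 subrr.
  by rewrite !coefP_gt// mulr0 mul0rn subr0.
move=> k kn.
have := pearson (P n * P k); rewrite derivM hornerM LB LD LZ.
rewrite (_ : 'X * _ = P k * ('X * (P n)^`()) + P n * ('X * (P k)^`())); last by ring.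
rewrite LD (@orth_low n); last exact: leq_trans (size_XderivP _) kn.
rewrite (orthE n k) (gtn_eqF kn) mul0r mulr0 !addr0.
rewrite (_ : 'X * (P n * P k) = P k * ('X * P n)); last by ring.
rewrite orth_X ?(ltnW kn)// (ltn_eqF kn) => /eqP; rewrite subr_eq => /eqP e.
rewrite mulrBr LB /= e mulrBr mulrDr -!scalerAr LB LD 3!LZ.
rewrite (orthE k n) (orthE k n.-1) (ltn_eqF kn) mul0r mulr0 add0r mulr_sumr L_sum.
rewrite (bigD1 (Ordinal kn)) //= big1 => [|j /negPf jk]; last first.
  rewrite -scalerAr LZ (orthE k j) eq_sym.
  by rewrite (_ : (j == k :> nat) = false) ?mul0r ?mulr0// -jk.
rewrite -scalerAr LZ addr0 divfK//.
have -> : (if k.+1 == n then h n else 0) = recB n * ((k == n.-1)%:R * h n.-1).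
  case: n kn {e} => // n _; rewrite eqSS /= /recB.
  by case: eqVneq => [_|_]; rewrite ?mul1r ?divfK// mul0r mulr0.
by ring.
Qed.

(** At 0 the factor y - x of the Christoffel-Darboux formula is -t, which absorbs the [t] before the
    kernel and leaves two neighbouring values. *)
Lemma structure_at0 n :
  (n%:R + rho n) * (P n).[0] + (1 - Rho n) * recB n * (P n.-1).[0] = 0.
Proof.
have /(congr1 (horner^~ 0)) := structure_relation n; case: n => [|n].
  by rewrite !hornerE /= => _; ring.
rewrite !hornerE horner_sum.
under eq_bigr do rewrite hornerZ.
have := christoffel_darboux n t 0; rewrite sub0r /=.
set S := \sum_(k < _) _ => e.
have -> : t * c * (P n.+1).[t] * S = - (c * (P n.+1).[t]) * (- t * S) by ring.
rewrite e => {e} /esym e; rewrite -[RHS]e /recB.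
by field; rewrite !h_neq0.
Qed.

(** The recurrence at 0 eliminates [P n.-1] from [structure_at0]; [recA_eq] and [rho_recurrence]
    then simplify the coefficient of [P n]. *)
Lemma raising_at0 n :
  (1 - Rho n) * (P n.+1).[0] + (n.+1%:R + al + rho n.+1) * (P n).[0] = 0.
Proof.
have r1 : rho n.+1 = Rho n * (t - recA n) - rho n by rewrite -rho_recurrence addrK.
have := three_term_horner n 0; rewrite mul0r => /eqP.
rewrite eq_sym addrAC addr_eq0 => /eqP p1.
have /eqP := structure_at0 n; rewrite addr_eq0 => /eqP s0.
have : (1 - Rho n) * ((P n.+1).[0] + recB n * (P n.-1).[0]) =
  (1 - Rho n) * (P n.+1).[0] - (n%:R + rho n) * (P n).[0] by rewrite s0; ring.
rewrite p1 => /eqP; rewrite eq_sym subr_eq => /eqP ->.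
rewrite r1 (recA_eq n) -natr1; ring.
Qed.

Lemma rho_sqr n : rho n.+1 ^+ 2 = recB n.+1 * Rho n.+1 * Rho n.
Proof. by rewrite /rho /recB; field; rewrite !h_neq0. Qed.

(** The second equation before division by R_n R_(n-1): the vanishing determinant, rewritten with
    [rho_sqr]. *)
Lemma ladder_compat n :
  recB n.+1 * (1 - Rho n.+1 - Rho n) =
  rho n.+1 * (2 * n.+1%:R + al) + n.+1%:R * (n.+1%:R + al).
Proof.
suff : (n.+1%:R + rho n.+1) * (n.+1%:R + al + rho n.+1)
  = recB n.+1 * (1 - Rho n.+1) * (1 - Rho n).
  have := rho_sqr n; set r := rho _; set b := recB _; set R1 := Rho n.+1.
  set R0 := Rho n => e1 e2.
  have -> : b * (1 - R1 - R0) = b * (1 - R1) * (1 - R0) - b * R1 * R0 by ring.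
  by rewrite -e1 -e2; ring.
have := structure_at0 n.+1; have := raising_at0 n.
have := @consecutive_nonroot n 0; rewrite -[n.+1.-1]/n.
set p1 := (P n.+1).[0]; set p0 := (P n).[0].
set U := 1 - Rho n; set V := n.+1%:R + al + _; set X := n.+1%:R + _.
set Y := (1 - Rho n.+1) * recB n.+1 => nz e1 e2.
suff : X * V - Y * U = 0 by move=> /eqP; rewrite subr_eq0 => /eqP ->; rewrite /Y; ring.
(* Cramer's rule: a nonzero determinant would force [p1] and [p0] both to vanish. *)
apply/eqP/negP => /negP D0; apply: nz; split; apply/eqP.
  rewrite -(mulrI_eq0 _ (mulfI D0)).
  have -> : (X * V - Y * U) * p1 = V * (X * p1 + Y * p0) - Y * (U * p1 + V * p0) by ring.
  by rewrite e1 e2 !mulr0 subrr.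
rewrite -(mulrI_eq0 _ (mulfI D0)).
have -> : (X * V - Y * U) * p0 = X * (U * p1 + V * p0) - U * (X * p1 + Y * p0) by ring.
by rewrite e1 e2 !mulr0 subrr.
Qed.

End SemiclassicalOPS.

(** * Gluing integrability and finiteness of root sets *)

Lemma integrable_setU d (T : measurableType d) (R : realType)
  (mu : {measure set T -> \bar R}) (A B : set T) (f : T -> \bar R) :
  measurable A -> measurable B -> [disjoint A & B] ->
  mu.-integrable A f -> mu.-integrable B f -> mu.-integrable (A `|` B) f.
Proof.
move=> mA mB AB /integrableP[mfA fA] /integrableP[mfB fB].
apply/integrableP; have mf := (measurable_funU f mA mB).2 (conj mfA mfB).
split=> //.
rewrite ge0_integral_setU//; last exact: measurableT_comp.
exact: lte_add_pinfty.
Qed.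

(** Each root splits off a linear factor, which lowers the size. Finiteness makes the zero set
    Lebesgue-null later. *)
Lemma roots_in_seq (R : idomainType) (p : {poly R}) : p != 0 ->
  exists r : seq R, forall x, p.[x] = 0 -> x \in r.
Proof.
have [n sp] := ubnP (size p); elim: n => // n IH in p sp *; move=> p0.
have [[y py]|noroot] := pselect (exists y, p.[y] = 0); last first.
  by exists [::] => x px; case: noroot; exists x.
have /factor_theorem[q pE] : root p y by apply/eqP.
have q0 : q != 0 by apply: contraNneq p0 => q0; rewrite pE q0 mul0r.
have [|//|r qr] := IH q.
  by move: sp; rewrite pE size_Mmonic ?monicXsubC// size_XsubC addn2.
exists (y :: r) => x; rewrite pE hornerM hornerXsubC => /eqP.
rewrite mulf_eq0 subr_eq0 inE => /orP[/eqP/qr ->|->//]; exact: orbT.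
Qed.

(** * Integrals of polynomials against x^s e^-x on half-lines *)

Section GammaDensity.
Context {R : realType}.
Implicit Types s a x : R.
Notation mu := (@lebesgue_measure R).

(** The integrand of Gamma(s + 1): the exponent is s, as in the weight, and not s - 1. *)
Definition gamma_density s x : R := x `^ s * expR (- x).

Local Notation g := gamma_density.

Lemma gamma_densityM s x : 0 < s -> 0 <= x -> x * g s x = g (s + 1) x.
Proof.
move=> s0 x0; rewrite /g mulrA -(@mulr_powRB1 _ x (s + 1)) ?addrK//.
by rewrite addr_gt0.
Qed.

Lemma gamma_density_ge0 s x : 0 <= g s x.
Proof. by rewrite mulr_ge0 ?powR_ge0 ?expR_ge0. Qed.

Lemma is_derive_gamma_density s x : 0 < x ->
  is_derive x 1 (g (s + 1)) ((s + 1 - x) * g s x).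
Proof.
move=> x0.
have dp := is_derive1_powR (s + 1) x0.
have de : is_derive x 1 (fun y : R => expR (- y)) (- expR (- x)).
  apply: is_derive_eq; rewrite /GRing.scale /=; ring.
apply: (@is_derive_eq _ _ _ (fun y => y `^ (s + 1) * expR (- y))).
rewrite addrK /GRing.scale /= /g.
have -> : x `^ (s + 1) = x * x `^ s.
  rewrite powRD ?powRr1 ?(ltW x0) 1?mulrC//; apply/implyP => _; exact: lt0r_neq0.
by ring.
Qed.

(** Squeeze between 0 and (2 s)^s e^(-x/2). *)
Lemma cvg_gamma_density s : 0 < s -> g s x @[x --> +oo] --> 0.
Proof.
move=> s0.
apply: (@squeeze_cvgr _ _ _ _ (cst 0)
  (fun x => expR (s * ln (2 * s)) * expR (- (2^-1 * x)))).
- near=> x; rewrite gamma_density_ge0/= /g -expRD.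
  have x0 : 0 < x by near: x; exact: nbhs_pinfty_gt.
  have s2 : 0 < 2 * s by rewrite mulr_gt0.
  rewrite /powR gt_eqF// -expRD ler_expR.
  have -> : ln x = ln (x / (2 * s)) + ln (2 * s).
    by rewrite -lnM ?posrE ?divr_gt0// divfK// lt0r_neq0.
  (* ln y < y at y = x / (2 s) leaves half of the exponential decay. *)
  have : s * ln (x / (2 * s)) <= s * (x / (2 * s)).
    by rewrite ler_pM2l// ltW// ln_sublinear// divr_gt0.
  have -> : s * (x / (2 * s)) = x / 2 by field; exact: lt0r_neq0.
  lra.
- exact: cvg_cst.
- rewrite -(mulr0 (expR (s * ln (2 * s)))); apply: cvgMr.
  apply: (@cvg_comp _ _ _ (fun x => 2^-1 * x) (fun x => expR (- x)) _
    (pinfty_nbhs R)); last exact: cvgr_expR.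
  by apply: gt0_cvgMry; rewrite ?invr_gt0//.
Unshelve. all: by end_near. Qed.

Lemma continuous_gamma_density s a : 0 < s -> 0 <= a ->
  {within `[a, +oo[, continuous (g s)}.
Proof.
move=> s0 a0.
suff : {within `[0, +oo[, continuous (g s)}.
  by apply: continuous_subspaceW; apply: subset_itvr; rewrite bnd_simp.
apply/continuous_within_itvcyP; split.
  move=> x; rewrite in_itv/= andbT => x0.
  apply/differentiable_continuous/derivable1_diffP.
  by rewrite -(subrK 1 s); have [] := is_derive_gamma_density (s - 1) x0.
(* The endpoint 0 escapes the derivative argument; there x^s has right limit 0 because s > 0. *)
rewrite /g powR0 ?gt_eqF// mul0r -[X in _ --> X](mul0r (expR (- 0))).
apply: cvgM; first exact: powR_cvg0.
apply: cvg_at_right_filter; apply: continuous_comp; first exact: opp_continuous.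
exact: continuous_expR.
Qed.

Lemma continuous_itvcc_gamma_density s a b : 0 < s -> 0 <= a ->
  {within `[a, b], continuous (g s)}.
Proof.
move=> s0 a0; apply: continuous_subspaceW (continuous_gamma_density s0 a0).
by apply: subset_itvl.
Qed.

Let within_slope (i : interval R) s : {within [set` i], continuous (g s)} ->
  {within [set` i], continuous (fun x => (s + 1 - x) * g s x)}.
Proof.
move=> /subspace_continuousP cg; apply/subspace_continuousP => x ix.
apply: cvgM; last exact: cg.
apply: cvg_within_filter; apply: cvgB; first exact: cvg_cst.
exact: cvg_id.
Qed.

(* The integrand changes sign at s + 1, and le0_continuous_FTC2y needs a constant
sign. *)
Lemma gamma_density_tailE s b : 0 < s -> s + 1 <= b ->
  (\int[mu]_(x in `[b, +oo[) ((s + 1 - x) * g s x)%:E = (- g (s + 1) b)%:E)%E.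
Proof.
move=> s0 sb; have b0 : 0 < b by apply: lt_le_trans sb; rewrite addr_gt0.
have s10 : 0 < s + 1 by rewrite addr_gt0.
rewrite (@le0_continuous_FTC2y _ _ (g (s + 1)) _ 0) ?EFinN ?sub0e//.
- move=> x bx; rewrite mulr_le0_ge0 ?gamma_density_ge0// subr_le0.
  exact: le_trans bx.
- by apply: within_slope; apply: continuous_gamma_density => //; exact: ltW.
- exact: cvg_gamma_density.
- by have /continuous_within_itvcyP[] := continuous_gamma_density s10 (ltW b0).
- by move=> x bx; have [] := is_derive_gamma_density s (lt_trans b0 bx).
- move=> x; rewrite in_itv/= andbT => bx; rewrite derive1E.
  by have [_ ->] := is_derive_gamma_density s (lt_trans b0 bx).
Qed.

Lemma measurable_gamma_density s : measurable_fun [set: R] (g s).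
Proof.
apply: measurable_funM; first exact: measurable_powR.
exact: measurableT_comp.
Qed.

(* Beyond s + 2, g s is dominated by the opposite of the derivative of g (s + 1). *)
Lemma integrable_gamma_density s a : 0 < s -> 0 <= a ->
  mu.-integrable `[a, +oo[ (EFin \o g s).
Proof.
move=> s0 a0.
suff : mu.-integrable `[0, +oo[ (EFin \o g s).
  by apply: integrableS => //; apply: subset_itvr; rewrite bnd_simp.
have b0 : 0 <= s + 2 by rewrite addr_ge0// ltW.
have bs : s + 1 <= s + 2 by lra.
rewrite (@itv_bndbnd_setU _ _ _ (BLeft (s + 2))) ?bnd_simp//.
apply: integrable_setU => //.
- apply/disj_setPS => y [/=]; rewrite !in_itv/= andbT => /andP[_ yb].
  by rewrite leNgt yb.
- suff : mu.-integrable `[0, s + 2] (EFin \o g s).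
    by apply: integrableS => //; apply: subset_itvl; rewrite bnd_simp.
  apply: continuous_compact_integrable; first exact: segment_compact.
  exact: continuous_itvcc_gamma_density.
- have mf : measurable_fun `[s + 2, +oo[ (fun x => (s + 1 - x) * g s x).
    apply/measurable_funTS/measurable_funM; last exact: measurable_gamma_density.
    exact: measurable_funB.
  have intf : mu.-integrable `[s + 2, +oo[ (fun x => ((s + 1 - x) * g s x)%:E).
    apply/integrableP; split; first exact/measurable_EFinP.
    (* Integrability follows from the explicit finite value of the integral. *)
    by rewrite integral_fin_num_abs// gamma_density_tailE.
  apply: le_integrable intf => //.
    by apply/measurable_EFinP/measurable_funTS; exact: measurable_gamma_density.
  move=> x; rewrite /= in_itv/= andbT => sx.
  rewrite lee_fin [leRHS]normrM ler_peMl// ler0_norm; lra.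
Qed.

Lemma horner_mul_gamma_density (p : {poly R}) c s x : 0 < s -> 0 <= x ->
  (p * 'X + c%:P).[x] * g s x = p.[x] * g (s + 1) x + c * g s x.
Proof. by move=> s0 x0; rewrite hornerMXaddC mulrDl -mulrA gamma_densityM. Qed.

(** Induction on [p] for all s at once: a factor ['X] is traded for s + 1. *)
Lemma integrable_horner_gamma_density (p : {poly R}) s a : 0 < s -> 0 <= a ->
  mu.-integrable `[a, +oo[ (fun x => (p.[x] * g s x)%:E).
Proof.
elim/poly_ind: p => [|p c IH] in s * => s0 a0.
  rewrite (_ : (fun _ => _) = cst 0%E); first exact: integrable0.
  by apply/funext => x; rewrite horner0 mul0r.
have s10 : 0 < s + 1 by rewrite addr_gt0.
have : mu.-integrable `[a, +oo[
    (fun x => (p.[x] * g (s + 1) x)%:E + c%:E * (g s x)%:E)%E.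
  apply: integrableD => //; first exact: IH.
  by apply: integrableZl => //; exact: integrable_gamma_density.
apply: eq_integrable => // x; rewrite inE/= in_itv/= andbT => ax.
by rewrite horner_mul_gamma_density// (le_trans a0).
Qed.

Lemma integrable_gamma_slope s a : 0 < s -> 0 <= a ->
  mu.-integrable `[a, +oo[ (EFin \o (fun x => (s + 1 - x) * g s x)).
Proof.
move=> s0 a0.
have := integrable_horner_gamma_density ((s + 1)%:P - 'X) s0 a0.
by apply: eq_integrable => // x _; rewrite hornerD hornerN hornerC hornerX.
Qed.

Lemma Rintegral_gamma_slope s a : 0 < s -> 0 <= a ->
  \int[mu]_(x in `[a, +oo[) ((s + 1 - x) * g s x) = - g (s + 1) a.
Proof.
move=> s0 a0.
have s10 : 0 < s + 1 by rewrite addr_gt0.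
(* This cut lies strictly beyond a, as the fundamental theorem on a segment requires, and past the
   sign change at s + 1. The boundary terms at [b] cancel. *)
set b := a + (s + 1); have ab : a < b by rewrite ltrDl.
have b0 : 0 <= b by rewrite addr_ge0// ltW.
have sb : s + 1 <= b by rewrite lerDr.
have := @Rintegral_itvB R _ (BLeft a) +oo%O b (integrable_gamma_slope s0 a0).
rewrite !bnd_simp => /(_ (ltW ab) isT) /eqP; rewrite subr_eq => /eqP ->.
rewrite Rintegral_itv_obnd_cbnd; last first.
  apply: integrableS (integrable_gamma_slope s0 b0) => //.
  by apply: subset_itvr; rewrite bnd_simp.
rewrite {1}/Rintegral gamma_density_tailE//=.
rewrite /Rintegral (@continuous_FTC2 _ _ (g (s + 1)))//=.
- by ring.
- by apply: within_slope; exact: continuous_itvcc_gamma_density.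
- have := @continuous_itvcc_gamma_density (s + 1) a b s10 a0.
  move=> /(continuous_within_itvP _ ab)[_ ga gb]; split => // x.
  rewrite in_itv/= => /andP[ax _].
  by have [] := is_derive_gamma_density s (le_lt_trans a0 ax).
- move=> x; rewrite in_itv/= => /andP[ax _]; rewrite derive1E.
  by have [_ ->] := is_derive_gamma_density s (le_lt_trans a0 ax).
Qed.

(** Induction on [p] for all s: on [p * 'X + c%:P] the operator gives x times the operator of
    parameter s + 1 on [p], plus c (s + 1 - x), whose integral is [Rintegral_gamma_slope]. *)
Lemma Rintegral_gamma_pearson (p : {poly R}) s a : 0 < s -> 0 <= a ->
  \int[mu]_(x in `[a, +oo[)
    (('X * p^`() + (s + 1) *: p - 'X * p).[x] * g s x) = - (a * p.[a] * g s a).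
Proof.
elim/poly_ind: p => [|p c IH] in s * => s0 a0.
  rewrite deriv0 !mulr0 scaler0 subr0 addr0 horner0 mulr0 mul0r oppr0.
  rewrite -[RHS](mul0r (fine (mu `[a, +oo[))) -Rintegral_cst//.
  by apply: eq_Rintegral => x _; rewrite horner0 mul0r.
have s10 : 0 < s + 1 by rewrite addr_gt0.
set q := 'X * p^`() + (s + 1 + 1) *: p - 'X * p.
transitivity (\int[mu]_(x in `[a, +oo[)
    (q.[x] * g (s + 1) x + c * ((s + 1 - x) * g s x))).
  apply: eq_Rintegral => x; rewrite inE/= in_itv/= andbT => ax.
  have -> : ('X * (p * 'X + c%:P)^`() + (s + 1) *: (p * 'X + c%:P)
      - 'X * (p * 'X + c%:P)).[x] = x * q.[x] + c * (s + 1 - x).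
    by rewrite /q derivMXaddC !hornerE; ring.
  rewrite -gamma_densityM// ?(le_trans a0)//; ring.
have intf := integrable_gamma_slope s0 a0.
rewrite (@RintegralD _ _ _ mu _ (fun x => q.[x] * g (s + 1) x)
  (fun x => c * ((s + 1 - x) * g s x)))//; first last.
- suff : mu.-integrable `[a, +oo[
    (fun x => c%:E * ((s + 1 - x) * g s x)%:E)%E by [].
  exact: integrableZl.
- exact: integrable_horner_gamma_density.
rewrite (@RintegralZl _ _ _ mu _ (fun x => (s + 1 - x) * g s x))//.
rewrite IH// Rintegral_gamma_slope// -gamma_densityM// hornerMXaddC.
ring.
Qed.

(** A zero integral would make the nonnegative integrand vanish almost everywhere, but its zeros are
    finitely many and the half-line has infinite measure. *)
Lemma Rintegral_gamma_sqr_gt0 (p : {poly R}) s a : 0 < s -> 0 <= a -> p != 0 ->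
  0 < \int[mu]_(x in `[a, +oo[) ((p * p).[x] * g s x).
Proof.
move=> s0 a0 p0; set f := fun x => (p * p).[x] * g s x.
have f0 x : 0 <= f x by rewrite mulr_ge0 ?gamma_density_ge0// hornerM -expr2 sqr_ge0.
rewrite lt_neqAle Rintegral_ge0 ?andbT; last by move=> x _; exact: f0.
have intf : mu.-integrable `[a, +oo[ (EFin \o f).
  exact: integrable_horner_gamma_density.
apply/negP => /eqP int0.
have : ae_eq mu `[a, +oo[%classic (EFin \o f) (cst 0%E).
  apply/ae_eq_integral_abs => //; first exact: measurable_int intf.
  rewrite (_ : (fun x => _) = EFin \o f); last first.
    by apply/funext => x; rewrite gee0_abs// lee_fin f0.
  by rewrite -[LHS]fineK ?integrable_fin_num//; congr EFin.
move=> [N [mN muN0 subN]].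
have [r Zr] := roots_in_seq p0.
have mD : measurable (`[a, +oo[%classic `\` N) by exact: measurableD.
have muD0 : mu (`[a, +oo[%classic `\` N) = 0%E.
  (* The point 0 joins the roots of [p] because x^s vanishes there. *)
  apply: countable_lebesgue_measure0; apply: (@sub_countable _ _ _ [set` 0 :: r]).
    apply: subset_card_le => x [/=]; rewrite in_itv/= andbT => ax Nx.
    rewrite inE; case: eqVneq => //= xn0; apply: Zr.
    have x0 : 0 < x by rewrite lt_neqAle eq_sym xn0 (le_trans a0).
    apply: contrapT => px0; apply: Nx; apply: subN => /= fx0.
    have [] : f x = 0 by apply: EFin_inj; apply: fx0; rewrite in_itv/= andbT.
    apply/eqP; rewrite /f /g hornerM !mulf_neq0 ?expR_eq0//; try exact/eqP.
    by rewrite gt_eqF// powR_gt0.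
  exact: finite_set_countable.
have : (mu `[a, +oo[%classic <= mu N + mu (`[a, +oo[%classic `\` N))%E.
  apply: le_trans (measureU2 _ mN mD); apply: le_measure; rewrite ?inE//.
    exact: measurableU.
  by move=> x Dx; have [Nx|Nx] := pselect (N x); [left|right].
by rewrite muN0 muD0 adde0 lebesgue_measure_itv/= ltry.
Qed.

End GammaDensity.

(** * The functional of the discontinuous weight *)

Section WeightFunctional.
Context {R : realType}.
Variables alpha A B t : R.
Hypotheses (alpha_gt0 : 0 < alpha) (A_ge0 : 0 <= A).
Hypotheses (B_gt0 : 0 < B) (t_gt0 : 0 < t).
Implicit Types p q : {poly R}.
Notation mu := (@lebesgue_measure R).

Definition tail_moment (a : R) p : R :=
  \int[mu]_(x in `[a, +oo[) (p.[x] * gamma_density alpha x).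

(** Splitting the step factor into two half-line integrals leaves a smooth density inside each open
    half-line. *)
Definition weight_moment p : R := A * tail_moment 0 p + B * tail_moment t p.

Let tail_momentD (a : R) p q : 0 <= a ->
  tail_moment a (p + q) = tail_moment a p + tail_moment a q.
Proof.
move=> a0; rewrite /tail_moment -RintegralD//;
  [|exact: integrable_horner_gamma_density..].
by apply: eq_Rintegral => x _; rewrite hornerD mulrDl.
Qed.

Let tail_momentZ (a c : R) p : 0 <= a -> tail_moment a (c *: p) = c * tail_moment a p.
Proof.
move=> a0; rewrite /tail_moment -RintegralZl//;
  last exact: integrable_horner_gamma_density.
by apply: eq_Rintegral => x _; rewrite hornerZ -[LHS]mulrA.
Qed.

Lemma weight_momentD p q :
  weight_moment (p + q) = weight_moment p + weight_moment q.
Proof. by rewrite /weight_moment !tail_momentD ?(ltW t_gt0)//; ring. Qed.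

Lemma weight_momentZ c p : weight_moment (c *: p) = c * weight_moment p.
Proof. by rewrite /weight_moment !tail_momentZ ?(ltW t_gt0)//; ring. Qed.

(** Strictness comes from the [B] term, since [A] may be 0. *)
Lemma weight_moment_sqr_gt0 p : p != 0 -> 0 < weight_moment (p * p).
Proof.
move=> p0; rewrite ltr_wpDl ?mulr_gt0// ?mulr_ge0//.
  by apply: ltW; apply: Rintegral_gamma_sqr_gt0.
by apply: Rintegral_gamma_sqr_gt0; rewrite ?(ltW t_gt0).
Qed.

(** The boundary term at 0 carries the factor a = 0; only the one at [t] survives. *)
Lemma weight_moment_pearson p :
  weight_moment ('X * p^`() + (alpha + 1) *: p - 'X * p) =
  - (B * t `^ alpha * expR (- t) * t * p.[t]).
Proof.
rewrite /weight_moment /tail_moment !Rintegral_gamma_pearson ?(ltW t_gt0)//.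
by rewrite /gamma_density; ring.
Qed.

Lemma wipE p q : wip alpha A B t p q = weight_moment (p * q).
Proof.
set f := fun x => (p * q).[x] * gamma_density alpha x.
have intf (a : R) : 0 <= a -> mu.-integrable `[a, +oo[ (EFin \o f).
  exact: integrable_horner_gamma_density.
(* Both moments are brought to the domain of [wip]. The interval is open at [t] since [heaviside] is
   0 at 0; the single point has measure zero. *)
have tE : tail_moment t (p * q) =
    \int[mu]_(x in `[0, +oo[) (f \_ `]t, +oo[%classic) x.
  rewrite -Rintegral_mkcondr.
  rewrite (_ : `[0, +oo[%classic `&` `]t, +oo[%classic = `]t, +oo[%classic); last first.
    apply/setIidr; apply: subset_itvr; rewrite bnd_simp; exact: ltW.
  rewrite Rintegral_itv_obnd_cbnd//.
  apply: integrableS (intf _ (ltW t_gt0)) => //.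
  by apply: subset_itvr; rewrite bnd_simp.
have intft : mu.-integrable `[0, +oo[ (EFin \o (f \_ `]t, +oo[%classic)).
  rewrite -restrict_EFin; apply/integrable_restrict => //.
  by apply: integrableS (intf 0 (lexx _)) => //; exact: measurableI.
rewrite /weight_moment tE /tail_moment -RintegralZl//; last exact: intf.
rewrite -[B * _]RintegralZl// -RintegralD//; first last.
- suff : mu.-integrable `[0, +oo[
    (fun x => B%:E * ((f \_ `]t, +oo[%classic) x)%:E)%E by [].
  exact: integrableZl.
- suff : mu.-integrable `[0, +oo[ (fun x => A%:E * (f x)%:E)%E by [].
  by apply: integrableZl => //; exact: intf.
apply: eq_Rintegral => x _; rewrite /weight /heaviside subr_gt0 patchE hornerM.
case: ifPn => tx.
  by rewrite mem_set/= ?in_itv/= ?tx// /f hornerM /gamma_density; ring.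
rewrite memNset/= ?in_itv/= ?andbT; last exact/negP.
(* Outside []t, +oo[] the restriction takes the default value [point], which is 0 here. *)
by rewrite -[point]/(0 : R) /gamma_density; ring.
Qed.

End WeightFunctional.

(** * Transfer of the algebraic identities to the weight *)

Theorem theorem1 (R : realType) (alpha A B t : R)
  (Halpha : 0 < alpha) (HA : 0 <= A) (HB : 0 < B) (Ht : 0 < t)
  (P : nat -> {poly R}) (HP : monic_OPS alpha A B t P) :
  (forall n : nat,
     rn alpha A B t P n.+1 + rn alpha A B t P n =
     Rn alpha A B t P n *
       (t - 2 * n%:R - alpha - 1 - t * Rn alpha A B t P n)) /\
  (forall n : nat, (1 <= n)%N ->
     (P n).[t] != 0 -> (P n.-1).[t] != 0 ->
     rn alpha A B t P n ^+ 2 *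
       ((Rn alpha A B t P n * Rn alpha A B t P n.-1)^-1
        - (Rn alpha A B t P n)^-1 - (Rn alpha A B t P n.-1)^-1) =
     rn alpha A B t P n * (2 * n%:R + alpha) + n%:R * (n%:R + alpha)) /\
  rn alpha A B t P 0 = 0 /\
  Rn alpha A B t P 0 = B * powR t alpha * expR (- t) / hn alpha A B t P 0 /\
  hn alpha A B t P 0 =
    A * Gamma (1 + alpha) +
    B * Rintegral lebesgue_measure `[t, +oo[
          (fun x => powR x alpha * expR (- x)).
Proof.
case: HP => monP orthP.
set L := weight_moment alpha A B t.
have P_monic n : P n \is monic by have [] := monP n.
have P_size n : size (P n) = n.+1 by have [] := monP n.
have P_orth m n : m <> n -> L (P m * P n) = 0.
  by move=> mn; rewrite /L -wipE//; exact: orthP.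
have h_gt0 n : 0 < L (P n * P n).
  by apply: weight_moment_sqr_gt0 => //; exact: monic_neq0.
have h_neq0 n : L (P n * P n) != 0 by rewrite gt_eqF.
have LD := weight_momentD A B Halpha Ht : forall p q, L (p + q) = L p + L q.
have LZ := weight_momentZ A B Halpha Ht : forall a p, L (a *: p) = a * L p.
have pearson := weight_moment_pearson A B Halpha Ht.
set c := B * t `^ alpha * expR (- t) in pearson.
have c_neq0 : c != 0 by rewrite gt_eqF// !mulr_gt0 ?powR_gt0 ?expR_gt0.
have hE n : hn alpha A B t P n = L (P n * P n) by exact: wipE.
have RE n : Rn alpha A B t P n = c * (P n).[t] ^+ 2 / L (P n * P n).
  by rewrite -hE.
have rE n : rn alpha A B t P n = rho L P c t n.
  by case: n => [//|n]; rewrite /rho -hE.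
have P01 : P 0 = 1 := P0_1 P_monic P_size.
split; [|split; [|split; [|split]]].
- move=> n; rewrite !rE RE (rho_recurrence LD LZ P_monic P_size P_orth h_neq0).
  rewrite (recA_eq LD LZ P_monic P_size P_orth h_neq0 pearson).
  ring.
- case=> // n _ pn1 pn0; rewrite !rE.
  have := ladder_compat LD LZ P_monic P_size P_orth h_neq0 pearson n.
  rewrite /= !RE => <-; rewrite rho_sqr//.
  rewrite /recB.
  have h0 := h_neq0 n; have h1 := h_neq0 n.+1.
  (* Nonzero values of both polynomials at [t] make R_n and R_(n-1) invertible, so [ladder_compat]
     can be divided by their product. *)
  by field; rewrite h0 h1 c_neq0 pn0 pn1.
- by [].
- by rewrite /Rn P01 hornerC expr1n mulr1.
- rewrite hE P01 mulr1 /L /weight_moment /tail_moment /Gamma.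
  congr (_ * _ + _ * _); apply: eq_Rintegral => x _; rewrite hornerC mul1r//.
  by rewrite addrAC subrr add0r.
Qed.
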